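(* Let $G$ be a weakly branch group (acting on a spherically homogeneous rooted tree). If for every $n\in\mathbb{N}$ the rigid stabilizer $\mathrm{rst}_G(n)$ is not an Engel group, then $\mathrm{R}(G)=1$.
   Context: Engel elements. For $g,x$ in a group $G$ put $[g,_0 x]=g$ and $[g,_n x]=[[g,_{n-1}x],x]$ for $n\ge 1$. An element $g\in G$ is a right Engel element of $G$ if for every $x\in G$ there is $n=n(g,x)\in\mathbb{N}$ with $[g,_n x]=1$. The set of right Engel elements is denoted $\mathrm{R}(G)$. A group $G$ is an Engel group if for all $g,x\in G$ there is $n\in\mathbb{N}$ with $[g,_n x]=1$. Trees. Let $(d_n)_{n\ge 1}$ be a sequence of integers greater than $1$. The corresponding spherically homogeneous rooted tree $\mathcal{T}$ is the rooted tree in which every vertex at level $n$ (distance $n$ from the root) has exactly $d_{n+1}$ immediate descendants. $\mathcal{L}_n$ is the set of vertices at level $n$, $\mathcal{T}_v$ is the subtree hanging from the vertex $v$, and $\mathrm{Aut}\,\mathcal{T}$ is the group of automorphisms of $\mathcal{T}$ (bijections of the vertex set preserving the root and incidence). For $G\le \mathrm{Aut}\,\mathcal{T}$ and a vertex $v$, the rigid stabilizer of $v$ is $\mathrm{rst}_G(v)=\{g\in G\mid g(u)=u \text{ for all vertices } u \text{ outside } \mathcal{T}_v\}$, and $\mathrm{rst}_G(n)=\langle \mathrm{rst}_G(v)\mid v\in\mathcal{L}_n\rangle=\prod_{v\in\mathcal{L}_n}\mathrm{rst}_G(v)$. The group $G$ is spherically transitive if it acts transitively on every $\mathcal{L}_n$.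 A weakly branch group is a spherically transitive subgroup $G\le\mathrm{Aut}\,\mathcal{T}$ with $\mathrm{rst}_G(n)\ne 1$ for all $n\in\mathbb{N}$. *)

(* Defs.v *)
From HB Require Import structures.
From mathcomp Require Import all_boot.
From mathcomp Require Import boolp classical_sets.
Set Implicit Arguments.
Unset Strict Implicit.
Unset Printing Implicit Defensive.
Local Open Scope classical_set_scope.
Local Open Scope group_scope.

Section Groups.
Variable gT : groupType.
Implicit Types (g x : gT) (H A : set gT).

Definition is_subgroup H : Prop := group_closed [in H].

Definition generated A : set gT := smallest is_subgroup A.

(* engel_comm g x n is [g,_n x]; the library's [~ a, b] is a^-1 b^-1 a b. *)
Fixpoint engel_comm g x (n : nat) : gT :=
  if n is m.+1 then [~ engel_comm g x m, x] else g.

(* For a subset H of gT, meant to be used with a subgroup H. *)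
Definition right_engel H : set gT :=
  [set g | H g /\ forall x, H x -> exists n, engel_comm g x n = 1].

Definition is_engel H : Prop :=
  forall g x, H g -> H x -> exists n, engel_comm g x n = 1.

End Groups.

Section Tree.
(* d n is the number of immediate descendants of each vertex at level n (so   *)
(* the sequence usually written (d_n)_{n >= 1} is shifted by one).  Vertices  *)
(* are the words x_0 ... x_(n-1) with x_i < d i; the root is the empty word   *)
(* and the level of a vertex is the length of the word.                       *)
Variable d : nat -> nat.

Definition is_vertex (s : seq nat) : bool :=
  all (fun i => (nth 0 s i < d i)%N) (iota 0 (size s)).

Definition vertex : Type := {s : seq nat | is_vertex s}.

Definition root_vertex : vertex := exist _ [::] isT.

Definition level (n : nat) : set vertex := [set v | size (val v) = n].

Definition descends (u v : vertex) : Prop :=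
  exists k, val v = rcons (val u) k.

Definition incident (u v : vertex) : Prop := descends u v \/ descends v u.

(* Vertices of the subtree hanging from v, including v. *)
Definition subtree (v : vertex) : set vertex :=
  [set u | prefix (val v) (val u)].

Record tree_aut : Type := TreeAut {
  aut_fun :> vertex -> vertex;
  aut_bij : bijective aut_fun;
  aut_root : aut_fun root_vertex = root_vertex;
  aut_incident : forall u v, incident (aut_fun u) (aut_fun v) <-> incident u v
}.

Lemma tree_autP (f g : tree_aut) : f =1 g -> f = g.
Proof.
case: f g => [f f1 f2 f3] [g g1 g2 g3] /= /funext fg; subst g.
by rewrite (Prop_irrelevance f1 g1) (Prop_irrelevance f2 g2)
  (Prop_irrelevance f3 g3).
Qed.

Definition aut_one : tree_aut :=
  @TreeAut id (Bijective (frefl _) (frefl _)) erefl (fun _ _ => iff_refl _).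

Section Mul.
Variables f g : tree_aut.

Fact aut_mul_root : (f \o g) root_vertex = root_vertex.
Proof. by rewrite /= !aut_root. Qed.

Fact aut_mul_incident u v : incident ((f \o g) u) ((f \o g) v) <-> incident u v.
Proof. by rewrite /= !aut_incident. Qed.

Definition aut_mul : tree_aut :=
  TreeAut (bij_comp (aut_bij f) (aut_bij g)) aut_mul_root aut_mul_incident.

End Mul.

Section Inv.
Variable f : tree_aut.

Fact aut_inv_ex : exists g : vertex -> vertex, cancel f g /\ cancel g f.
Proof. by case: (aut_bij f) => g fK gK; exists g. Qed.

Definition aut_inv_fun : vertex -> vertex := projT1 (cid aut_inv_ex).

Fact aut_funK : cancel f aut_inv_fun.
Proof. by rewrite /aut_inv_fun; case: cid => g []. Qed.

Fact aut_inv_funK : cancel aut_inv_fun f.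
Proof. by rewrite /aut_inv_fun; case: cid => g []. Qed.

Fact aut_inv_bij : bijective aut_inv_fun.
Proof. exact: Bijective aut_inv_funK aut_funK. Qed.

Fact aut_inv_root : aut_inv_fun root_vertex = root_vertex.
Proof. by rewrite -{1}(aut_root f) aut_funK. Qed.

Fact aut_inv_incident u v :
  incident (aut_inv_fun u) (aut_inv_fun v) <-> incident u v.
Proof. by rewrite -(aut_incident f) !aut_inv_funK. Qed.

Definition aut_inv : tree_aut :=
  TreeAut aut_inv_bij aut_inv_root aut_inv_incident.

End Inv.

Fact aut_mulA : associative aut_mul.
Proof. by move=> f g h; apply: tree_autP. Qed.

Fact aut_mul1 : left_id aut_one aut_mul.
Proof. by move=> f; apply: tree_autP. Qed.

Fact aut_mulr1 : right_id aut_one aut_mul.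
Proof. by move=> f; apply: tree_autP. Qed.

Fact aut_mulV : left_inverse aut_one aut_inv aut_mul.
Proof. by move=> f; apply: tree_autP => u /=; rewrite aut_funK. Qed.

Fact aut_mulrV : right_inverse aut_one aut_inv aut_mul.
Proof. by move=> f; apply: tree_autP => u /=; rewrite aut_inv_funK. Qed.

(* Aut T, with product (f * g) u = f (g u). *)
HB.instance Definition _ := gen_eqMixin tree_aut.
HB.instance Definition _ := gen_choiceMixin tree_aut.
HB.instance Definition _ := isGroup.Build tree_aut
  aut_mulA aut_mul1 aut_mulr1 aut_mulV aut_mulrV.

Implicit Type G : set tree_aut.

Definition rigid_stab G (v : vertex) : set tree_aut :=
  [set g | G g /\ forall u, ~ subtree v u -> g u = u].

Definition rigid_level_stab G (n : nat) : set tree_aut :=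
  generated (\bigcup_(v in level n) rigid_stab G v).

Definition spherically_transitive G : Prop :=
  forall n u v, level n u -> level n v -> exists2 g : tree_aut, G g & g u = v.

Definition weakly_branch G : Prop :=
  [/\ is_subgroup G, spherically_transitive G
    & forall n, rigid_level_stab G n <> [set 1]].

End Tree.

(* Main.v *)
Require Import Defs.
From mathcomp Require Import all_boot.
From mathcomp Require Import boolp classical_sets.

(* If g moves the vertex w and a, b lie in the rigid stabilizer of w, put       *)
(* x = g (b a^-1) g^-1 b.  The first factor is supported below g(w), which is   *)
(* disjoint from the subtree at w, so on that subtree x acts as b and [g, x] as *)
(* a; hence [g,_(k+1) x] acts there as [a,_k b].  A nontrivial right Engel      *)
(* element thus makes the rigid stabilizer of w Engel.  By transitivity all the *)
(* rigid stabilizers of the level of w are then Engel, and so is the rigid      *)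
(* stabilizer of that level, their finite direct product.                       *)

Set Implicit Arguments.
Unset Strict Implicit.
Unset Printing Implicit Defensive.
Local Open Scope classical_set_scope.
Local Open Scope group_scope.

(** The argument is contrapositive: a right Engel element moving [w] makes the rigid stabilizer of
    the level of [w] Engel. It works by localisation: when [f] and [g] act on the subtree at [v] as
    elements [a] and [b] of its rigid stabilizer, their iterated commutators act there as those of
    [a] and [b] ([agree_engel_comm]). [right_engel_rigid_stab] uses this to pass from the right
    Engel element to any pair [a], [b] at [w]; [is_engel_rigid_level_stab] uses it to glue the
    vertices of a level, with [level_bounded] supplying a common exponent. *)

Section Groups.
Variable gT : groupType.
Implicit Types (g x y : gT) (H : set gT).

Lemma is_subgroupP H :
  is_subgroup H <-> H 1 /\ forall x y, H x -> H y -> H (x / y).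
Proof.
split=> [[H1 HB]|[H1 HB]].
  split=> [|x y Hx Hy]; first exact: set_mem.
  by apply/set_mem/HB; apply/mem_set.
split=> [|x y /set_mem Hx /set_mem Hy]; first exact: mem_set.
exact/mem_set/HB.
Qed.

Lemma subgroupV H x : is_subgroup H -> H x -> H x^-1.
Proof. by move=> /is_subgroupP[H1 HB] Hx; rewrite -(mul1g x^-1); exact: HB. Qed.

Lemma subgroupM H x y : is_subgroup H -> H x -> H y -> H (x * y).
Proof.
move=> HH Hx Hy; rewrite -(invgK y).
by move/is_subgroupP: (HH) => [_]; apply=> //; exact: subgroupV.
Qed.

Lemma engel_commSr g x n : engel_comm g x n.+1 = engel_comm [~ g, x] x n.
Proof. by elim: n => //= n <-. Qed.

Lemma engel_commJ g x y n :
  engel_comm (g ^ y) (x ^ y) n = engel_comm g x n ^ y.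
Proof. by elim: n => //= n ->; rewrite conjRg. Qed.

Lemma engel_comm_eq1_leq g x m n :
  (m <= n)%N -> engel_comm g x m = 1 -> engel_comm g x n = 1.
Proof.
move=> /subnK <-; elim: (n - m)%N => //= k IH /IH ->.
exact: comm1g.
Qed.

End Groups.

Section Tree.
Variable d : nat -> nat.
Implicit Types (u v w : vertex d) (f g h x : tree_aut d) (G : set (tree_aut d)).

(** * Words and finiteness of levels *)

Lemma is_vertex_rcons s k :
  is_vertex d (rcons s k) = is_vertex d s && (k < d (size s))%N.
Proof.
rewrite /is_vertex size_rcons -addn1 iotaD all_cat /= andbT add0n.
rewrite nth_rcons ltnn eqxx; congr (_ && _).
apply: eq_in_all => i; rewrite mem_iota /= add0n => lt_i_s.
by rewrite nth_rcons lt_i_s.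
Qed.

Lemma is_vertex_catl s t : is_vertex d (s ++ t) -> is_vertex d s.
Proof.
elim/last_ind: t => [|t k IH]; first by rewrite cats0.
by rewrite -rcons_cat is_vertex_rcons => /andP[/IH].
Qed.

Lemma vertex_ind (P : vertex d -> Prop) :
  P (root_vertex d) -> (forall u v, descends u v -> P u -> P v) ->
  forall v, P v.
Proof.
move=> P0 PS [s sP]; elim/last_ind: s sP => [|s k IH] sP.
  by rewrite (_ : exist _ _ _ = root_vertex d) //; apply: val_inj.
have sP' : is_vertex d s by move: sP; rewrite is_vertex_rcons => /andP[].
by apply: PS (IH sP'); exists k.
Qed.

(** Finiteness of a level, phrased as the existence of a maximum so that the vertices need not be
    enumerated. *)
Lemma level_bounded (P : seq nat -> nat -> Prop) n :
    (forall s j k, (j <= k)%N -> P s j -> P s k) ->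
    (forall s, is_vertex d s -> size s = n -> exists k, P s k) ->
  exists k, forall s, is_vertex d s -> size s = n -> P s k.
Proof.
elim: n P => [|n IH] P Pmono Pex.
  have [k Pk] := Pex [::] isT erefl.
  by exists k => s _ /size0nil ->.
pose Q s k := forall i, (i < d (size s))%N -> P (rcons s i) k.
have [||k Qk] := IH Q.
- by move=> s j k le_jk Qj i lt_i; apply: Pmono le_jk _; exact: Qj.
- move=> s sP sn; rewrite /Q.
  (* Generalised below to [m <= d (size s)], for an induction on the number [m] of children already
     bounded. *)
  have : (d (size s) <= d (size s))%N by [].
  elim: {1 3}(d (size s)) => [|m IHm] lt_m; first by exists 0%N.
  have [k Pk] := IHm (ltnW lt_m).
  have [] := Pex (rcons s m); rewrite ?size_rcons ?sn //.
    by rewrite is_vertex_rcons sP.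
  move=> j Pj; exists (maxn k j) => i.
  rewrite ltnS leq_eqVlt => /predU1P[->|/Pk].
    by apply: Pmono Pj; exact: leq_maxr.
  by apply: Pmono; exact: leq_maxl.
exists k => s; case/lastP: s => // s i.
rewrite is_vertex_rcons size_rcons => /andP[sP lt_i] [sn].
exact: Qk.
Qed.

(** * Automorphisms preserve levels and subtrees *)

Lemma descends_inj u u' v : descends u v -> descends u' v -> u = u'.
Proof.
move=> [k vE] [k' /eqP]; rewrite vE eqseq_rcons => /andP[/eqP + _].
exact: val_inj.
Qed.

(** Incidence is symmetric, so the direction of edges is recovered from the root: were [f v] the
    parent of [f u], it would equal the image of the parent [u'] of [u], forcing [v = u'], against
    the lengths. *)
Lemma aut_descends f u v : descends u v -> descends (f u) (f v).
Proof.
elim/vertex_ind: u v => [|u' u u'u IH] v uv.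
  have : incident (f (root_vertex d)) (f v) by apply/aut_incident; left.
  case=> //; rewrite aut_root => -[k] /= /esym/eqP.
  by rewrite -size_eq0 size_rcons.
have : incident (f u) (f v) by apply/aut_incident; left.
case=> // /descends_inj/(_ (IH _ u'u)) /(bij_inj (aut_bij f)) vu'.
case: uv u'u => k; rewrite vu' => + [j] uE.
rewrite uE => /(congr1 size) /eqP.
by rewrite !size_rcons eqn_leq andbC ltnNge leqnSn.
Qed.

Lemma size_aut f u : size (val (f u)) = size (val u).
Proof.
elim/vertex_ind: u => [|u v uv IH]; first by rewrite aut_root.
have [k ->] := aut_descends f uv; have [j ->] := uv.
by rewrite !size_rcons IH.
Qed.

Lemma aut_subtree f u v : subtree v u -> subtree (f v) (f u).
Proof.
elim/vertex_ind: u => [|u u' uu' IH].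
  move=> /size_prefix; rewrite leqn0 => /nilP v0.
  by rewrite (_ : v = root_vertex d) ; [exact: prefix_refl | exact: val_inj].
have [k u'E] := uu'.
move=> vu'.
have /eqP vE : take (size (val v)) (val u') == val v by rewrite -prefixE.
have [lt_u_v|le_v_u] := ltnP (size (val u)) (size (val v)).
  have -> : v = u'.
    by apply: val_inj; rewrite -vE u'E take_oversize // size_rcons.
  exact: prefix_refl.
have vu : subtree v u.
  by rewrite /subtree /= prefixE -{2}vE u'E -cats1 takel_cat.
have [j fu'E] := aut_descends f uu'.
rewrite /subtree /mkset fu'E.
exact: prefix_trans (IH vu) (prefix_rcons _ _).
Qed.

Lemma subtree_disjoint v w u :
  size (val v) = size (val w) -> subtree v u -> subtree w u -> v = w.
Proof.
rewrite /subtree /mkset !prefixE => vw /eqP vu /eqP wu.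
by apply: val_inj; rewrite -vu -wu vw.
Qed.

(** * Rigid stabilizers *)

Lemma aut_mulE f g u : (f * g) u = f (g u).
Proof. by []. Qed.

Lemma aut_mulKV f u : f (f^-1 u) = u.
Proof. by rewrite -aut_mulE mulgV. Qed.

Lemma aut_mulVK f u : f^-1 (f u) = u.
Proof. by rewrite -aut_mulE mulVg. Qed.

Lemma subtree_autV f v u : subtree v (f^-1 u) <-> subtree (f v) u.
Proof.
split=> [/(aut_subtree f)|/(aut_subtree f^-1)]; first by rewrite aut_mulKV.
by rewrite aut_mulVK.
Qed.

(** If [h u] left the subtree it would be fixed by [h], and injectivity would give [h u = u]. *)
Lemma rigid_stab_subtree G v h u :
  rigid_stab G v h -> subtree v u -> subtree v (h u).
Proof.
move=> [_ hv] vu; apply: contrapT => nvhu; apply: (nvhu).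
by rewrite (bij_inj (aut_bij h) (hv _ nvhu)).
Qed.

Lemma rigid_stab_subgroup G v : is_subgroup G -> is_subgroup (rigid_stab G v).
Proof.
move=> /is_subgroupP[G1 GB]; apply/is_subgroupP; split=> [|f g]; first by split.
move=> [Gf fv] [Gg gv]; split=> [|u nvu]; first exact: GB.
by rewrite aut_mulE -{1}(gv _ nvu) aut_mulVK fv.
Qed.

Lemma rigid_stabJ G v g f :
  is_subgroup G -> G g -> rigid_stab G (g v) f -> rigid_stab G v (f ^ g).
Proof.
move=> GG Gg [Gf fv]; split.
  rewrite /conjg; do 2 ?apply: subgroupM => //; exact: subgroupV.
move=> u nvu; rewrite /conjg !aut_mulE fv ?aut_mulVK // => /subtree_autV.
by rewrite aut_mulVK.
Qed.

(** * Localisation to a subtree *)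

Definition agree v f h := forall u, subtree v u -> f u = h u.

Section Agree.
Variables (G : set (tree_aut d)) (v : vertex d).
Hypothesis GG : is_subgroup G.

(** The right factor acts first, so [h2] must keep [u] in the subtree before [fh1] can be
    applied. *)
Lemma agreeM f1 h1 f2 h2 :
    rigid_stab G v h2 ->
  agree v f1 h1 -> agree v f2 h2 -> agree v (f1 * f2) (h1 * h2).
Proof.
move=> h2v fh1 fh2 u vu; rewrite !aut_mulE fh2 // fh1 //.
exact: rigid_stab_subtree h2v vu.
Qed.

Lemma agreeV f h : rigid_stab G v h -> agree v f h -> agree v f^-1 h^-1.
Proof.
move=> /(subgroupV (rigid_stab_subgroup v GG)) hv fh u vu.
rewrite -{1}(aut_mulKV h u) -fh ?aut_mulVK //.
exact: rigid_stab_subtree hv vu.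
Qed.

Lemma rigid_stab_engel_comm a b n :
  rigid_stab G v a -> rigid_stab G v b -> rigid_stab G v (engel_comm a b n).
Proof.
move=> av bv; elim: n => //= n IH; rewrite /commg /conjg.
have vG := rigid_stab_subgroup v GG.
by do 3 ?[apply: subgroupM => //]; apply: subgroupV.
Qed.

Lemma agree_engel_comm f a g b n :
    rigid_stab G v a -> rigid_stab G v b -> agree v f a -> agree v g b ->
  agree v (engel_comm f g n) (engel_comm a b n).
Proof.
move=> av bv fa gb; elim: n => //= n IH; rewrite /commg /conjg.
have vG := rigid_stab_subgroup v GG.
have nv := rigid_stab_engel_comm n av bv.
do 3 ?[apply: agreeM => //]; do ?[apply: subgroupM => //];
  by [apply: agreeV | apply: subgroupV].
Qed.

End Agree.

(** * Transfer of the Engel condition *)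

Lemma right_engel_rigid_stab G g w :
    is_subgroup G -> right_engel G g -> g w <> w -> is_engel (rigid_stab G w).
Proof.
move=> GG [Gg gE] gw a b aw bw.
have wG := rigid_stab_subgroup w GG.
have aVw := subgroupV wG aw; have bVw := subgroupV wG bw.
have disj h u : rigid_stab G w h -> subtree (g w) u -> h u = u.
  move=> [_ hw] gwu; apply: hw => wu; apply: gw.
  by apply: subtree_disjoint gwu wu; rewrite size_aut.
have disjV h u : rigid_stab G w h -> subtree w u -> h (g^-1 u) = g^-1 u.
  by move=> [_ hw] wu; apply: hw => /subtree_autV gwu; apply: gw;
     apply: subtree_disjoint gwu wu; rewrite size_aut.
(* Not a local definition: rewriting with aut_mulE would unfold it. *)
have [x xE] : exists x, x = g * (b * a^-1) * g^-1 * b by eexists.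
have Gx : G x.
  have [[Ga _] [Gb _]] := (aw, bw); rewrite xE.
  by do 4 ?[apply: subgroupM => //]; exact: subgroupV.
have xb : agree w x b.
  move=> u wu; rewrite xE !aut_mulE.
  have wbu := rigid_stab_subtree bw wu.
  by rewrite (disjV a^-1) // (disjV b) // aut_mulKV.
(* The factor [b * a^-1] in [x] is chosen so that [[~ g, x]] sends [u] to [g^-1 (b^-1 (g (a u)))];
   as [b^-1] fixes the subtree at [g w], this is [a u]. *)
have gxa : agree w [~ g, x] a.
  move=> u wu; rewrite /commg /conjg !aut_mulE xb // xE !invgM !invgK.
  rewrite !aut_mulE !aut_mulVK.
  have wau := rigid_stab_subtree aw wu.
  by rewrite (disj b^-1) ?aut_mulVK //; exact: aut_subtree.
(* The exponent is raised by one because the first commutator with [x] is spent on turning [g] into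
   [a]. *)
have [n gxn] := gE x Gx; have := engel_comm_eq1_leq (leqnSn n) gxn.
rewrite engel_commSr => gx1; exists n.
have [_ abw] := rigid_stab_engel_comm GG n aw bw.
apply: tree_autP => u; have [wu|nwu] := pselect (subtree w u).
  by rewrite -(agree_engel_comm GG n aw bw gxa xb) // gx1.
exact: abw.
Qed.

(** Conjugation by an element of [G] taking [w] to [v] carries one rigid stabilizer into the other
    and respects iterated commutators. *)
Lemma is_engel_rigid_stab_level G v w :
    is_subgroup G -> spherically_transitive G ->
    size (val v) = size (val w) ->
  is_engel (rigid_stab G w) -> is_engel (rigid_stab G v).
Proof.
move=> GG GT vw wE a b av bv.
have [g Gg gw] := GT _ w v erefl vw; rewrite -gw in av bv.
have [n] := wE _ _ (rigid_stabJ GG Gg av) (rigid_stabJ GG Gg bv).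
by rewrite engel_commJ => /eqP; rewrite conjg_eq1 => /eqP abn; exists n.
Qed.

(** Stands in for the direct product decomposition: [h] is the component of [f] at [v]. The two
    properties define a subgroup containing the generators. *)
Lemma rigid_level_stab_agree G n f :
    is_subgroup G -> rigid_level_stab G n f ->
  (forall u, (size (val u) < n)%N -> f u = u) /\
  (forall v, level n v -> exists2 h, rigid_stab G v h & agree v f h).
Proof.
move=> GG; move: f; apply: smallest_sub.
  apply/is_subgroupP; split=> [|f g [f_lt fv] [g_lt gv]].
    split=> // v _; exists 1 => //.
    by have /is_subgroupP[] := rigid_stab_subgroup v GG.
  split=> [u lt_u|v vn].
    by rewrite aut_mulE -{1}(g_lt u lt_u) aut_mulVK f_lt.
  have vG := rigid_stab_subgroup v GG.
  have [[a av fa] [b bv gb]] := (fv v vn, gv v vn).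
  have bVv := subgroupV vG bv.
  exists (a * b^-1); first exact: subgroupM.
  by apply: (agreeM bVv fa); exact: (agreeV GG bv gb).
move=> f [w wn fw]; split=> [u lt_u|v vn].
  case: fw => _; apply; move=> /size_prefix.
  by rewrite wn leqNgt lt_u.
(* A generator at [w] is its own component there and has component 1 elsewhere, since subtrees of
   one level are disjoint. *)
have [->|vw] := pselect (v = w); first by exists f.
exists 1; first by have /is_subgroupP[] := rigid_stab_subgroup v GG.
move=> u vu; case: fw => _; apply => wu; apply: vw.
by apply: subtree_disjoint vu wu; rewrite vn wn.
Qed.

Lemma is_engel_rigid_level_stab G n :
    is_subgroup G -> (forall v, level n v -> is_engel (rigid_stab G v)) ->
  is_engel (rigid_level_stab G n).
Proof.
move=> GG vE f g /(rigid_level_stab_agree GG)[f_lt fv].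
move=> /(rigid_level_stab_agree GG)[g_lt gv].
(* Quantifying over all [j] above [k] makes [P] monotone in [k], as [level_bounded] requires. *)
pose P s k := forall j u, (k <= j)%N -> prefix s (val u) ->
  engel_comm f g j u = u.
have [||k Pk] := @level_bounded P n.
- by move=> s i k le_ik Pi j u le_kj; apply: Pi; exact: leq_trans le_kj.
- move=> s sP sn; have vn : level n (exist _ s sP : vertex d) by [].
  have [[a av fa] [b bv gb]] := (fv _ vn, gv _ vn).
  have [k abk] := vE _ vn a b av bv; exists k => j u le_kj su.
  rewrite (agree_engel_comm GG j av bv fa gb) //.
  by rewrite (engel_comm_eq1_leq le_kj abk).
exists k; apply: tree_autP => u.
(* Above the level [f] and [g] fix [u], hence so do their commutators; any other [u] lies below its
   prefix of length [n]. *)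
have [lt_u|le_u] := ltnP (size (val u)) n.
  have fixV h : h u = u -> h^-1 u = u by move=> hu; rewrite -{1}hu aut_mulVK.
  have [fu gu] := (f_lt u lt_u, g_lt u lt_u).
  rewrite -[RHS]/u; elim: k {Pk} => // k IH.
  rewrite -[engel_comm f g k.+1]/[~ engel_comm f g k, g] commgEl conjgE.
  by rewrite !aut_mulE gu IH (fixV g) // fixV.
apply: (Pk (take n (val u))) => //; last exact: prefix_take.
  by apply: (@is_vertex_catl _ (drop n (val u))); rewrite cat_take_drop (valP u).
by rewrite size_takel.
Qed.

End Tree.

Theorem theoremC (d : nat -> nat) (hd : forall n : nat, (1 < d n)%N)
    (G : set (tree_aut d)) (hG : weakly_branch G)
    (hE : forall n : nat, ~ is_engel (rigid_level_stab G n)) :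
  right_engel G = [set 1%g]%classic.
Proof.
have [GG GT _] := hG.
apply/seteqP; split=> [g gR|_ ->]; last first.
  by split=> [|x _]; [have /is_subgroupP[] := GG | exists 0%N].
apply: tree_autP => w; apply: contrapT => gw.
apply: (hE (size (val w))); apply: is_engel_rigid_level_stab => // v vw.
by apply: is_engel_rigid_stab_level (right_engel_rigid_stab GG gR gw).
Qed.
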